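(* Let $G$ be a connected Lie group of polynomial growth and let $G \curvearrowright X$ be a free continuous action on a second-countable locally compact Hausdorff space $X$. Then $G\curvearrowright X$ admits slices: for every compact identity neighbourhood $K\subseteq G$ and every $x\in X$ there exists a $K$-slice $S\subseteq X$ such that $x\in\mathrm{int}_{\mathrm{tube}}(S)$.
   Context: A compactly generated locally compact group with compact symmetric generating set $\Omega$ and Haar measure $m$ has polynomial growth if there are $d\in\mathbb{N}$, $C>0$ with $m(\Omega^n)\le Cn^d$ for all $n \geq 1$. Let $K\subseteq G$ be a compact identity neighbourhood. A $K$-slice is a compact subset $S\subseteq X$ such that the map $K\times S\to X$, $(g,x)\mapsto gx$, is injective. The tube interior of a $K$-slice $S$ is $\mathrm{int}_{\mathrm{tube}}(S)=S\cap(KS)^\circ$, where $(KS)^\circ$ is the interior of $KS$ in $X$ (this does not depend on the choice of $K$). *)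

(* Defs.v *)
From HB Require Import structures.
From mathcomp Require Import all_boot all_order all_algebra.
From mathcomp Require Import all_classical all_reals all_analysis.
Import Order.TTheory GRing.Theory Num.Theory.
Import numFieldNormedType.Exports.

Set Implicit Arguments.
Unset Strict Implicit.
Unset Printing Implicit Defensive.

Local Open Scope classical_set_scope.
Local Open Scope ring_scope.

(** Topological groups, written multiplicatively. The distinguished point of
    [PointedTopological] plays no role: it is there because [measurableType]s,
    hence the Borel sigma-algebra below, are pointed. *)

HB.mixin Record isTopologicalGroup G of PointedTopological G & Group G := {
  mulg_continuous : continuous (fun p : G * G => (p.1 * p.2)%g) ;
  invg_continuous : continuous (fun x : G => (x^-1)%g) }.

#[short(type="topologicalGroupType")]
HB.structure Definition TopologicalGroup :=
  { G of PointedTopological G & Group G & isTopologicalGroup G }.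

Section smooth_maps.
Context {R : realType} {m n : nat}.

(** [U] is always open below, so that ['D_v f x] with [U x] does not depend on
    the values of [f] outside [U]. *)
Fixpoint class_C (k : nat) (U : set 'rV[R]_m) (f : 'rV[R]_m -> 'rV[R]_n)
    : Prop :=
  {within U, continuous f} /\
  if k is k'.+1 then
    forall i : 'I_m,
      (forall x, U x -> derivable f x (delta_mx 0 i)) /\
      class_C k' U (fun x => 'D_(delta_mx 0 i) f x)
  else True.

Definition smooth_on (U : set 'rV[R]_m) (f : 'rV[R]_m -> 'rV[R]_n) : Prop :=
  forall k, class_C k U f.

End smooth_maps.

(** A chart is a homeomorphism from an open set of [M] onto an open set of R^n.
    [chart_fun] and [chart_inv] are total, with irrelevant values outside
    [chart_dom] and [chart_cod]. *)
Record chart (R : realType) (n : nat) (M : topologicalType) := Chart {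
  chart_dom : set M ;
  chart_fun : M -> 'rV[R]_n ;
  chart_inv : 'rV[R]_n -> M }.

Section manifolds.
Context {R : realType}.

Definition chart_cod n (M : topologicalType) (a : chart R n M)
  : set 'rV[R]_n := chart_fun a @` chart_dom a.

Definition is_chart n (M : topologicalType) (a : chart R n M) : Prop :=
  [/\ open (chart_dom a), open (chart_cod a),
      forall x, chart_dom a x -> chart_inv a (chart_fun a x) = x,
      {within chart_dom a, continuous (chart_fun a)} &
      {within chart_cod a, continuous (chart_inv a)}].

(** The expression of [f] in the charts [a] and [b] is smooth where defined. *)
Definition smooth_in_charts m n (M N : topologicalType)
    (a : chart R m M) (b : chart R n N) (f : M -> N) : Prop :=
  smooth_on [set v | chart_cod a v /\ chart_dom b (f (chart_inv a v))]
            (fun v => chart_fun b (f (chart_inv a v))).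

Definition smooth_atlas n (M : topologicalType) (A : set (chart R n M))
    : Prop :=
  [/\ forall a, A a -> is_chart a,
      forall x, exists2 a, A a & chart_dom a x &
      forall a b, A a -> A b -> smooth_in_charts a b idfun].

Definition smooth_manifold n (M : topologicalType) (A : set (chart R n M))
    : Prop :=
  [/\ hausdorff_space M, @second_countable M & smooth_atlas A].

Definition smooth_map m n (M N : topologicalType)
    (A : set (chart R m M)) (B : set (chart R n N)) (f : M -> N) : Prop :=
  continuous f /\ forall a b, A a -> B b -> smooth_in_charts a b f.

Definition prod_chart m n (M N : topologicalType)
    (a : chart R m M) (b : chart R n N) : chart R (m + n) (M * N)%type :=
  Chart (chart_dom a `*` chart_dom b)
    (fun p => row_mx (chart_fun a p.1) (chart_fun b p.2))
    (fun v => (chart_inv a (lsubmx v), chart_inv b (rsubmx v))).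

Definition prod_atlas m n (M N : topologicalType)
    (A : set (chart R m M)) (B : set (chart R n N))
    : set (chart R (m + n) (M * N)%type) :=
  [set prod_chart a b | a in A & b in B].

Definition lie_group n (G : topologicalGroupType) (A : set (chart R n G))
    : Prop :=
  [/\ smooth_manifold A,
      smooth_map (prod_atlas A A) A (fun p : G * G => (p.1 * p.2)%g) &
      smooth_map A A (fun x : G => (x^-1)%g)].

End manifolds.

Section growth.
Variable G : topologicalGroupType.

Local Notation borel := (g_sigma_algebraType (@open G)).

(** A left Haar measure: a nonzero left-invariant Radon measure. *)
Definition haar_measure (R : realType) (mu : {measure set borel -> \bar R})
    : Prop :=
  [/\ mu [set: G] != 0%E,
      forall (g : G) (B : set borel), measurable B ->
        mu [set (g * x)%g | x in B] = mu B,
      forall K : set G, compact K -> (mu K < +oo)%E,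
      forall B : set borel, measurable B ->
        mu B = ereal_inf [set mu U | U in [set U : set G | open U /\ B `<=` U]] &
      forall U : set G, open U ->
        mu U = ereal_sup [set mu K | K in [set K : set G | compact K /\ K `<=` U]]].

Definition is_subgroup (H : set G) : Prop :=
  [/\ H 1%g, forall x y, H x -> H y -> H (x * y)%g &
      forall x, H x -> H (x^-1)%g].

Definition generating (Omega : set G) : Prop :=
  smallest is_subgroup Omega = [set: G].

Definition symmetric_set (Omega : set G) : Prop :=
  [set (x^-1)%g | x in Omega] = Omega.

Fixpoint set_pow (Omega : set G) (n : nat) : set G :=
  if n is n'.+1 then [set (x * y)%g | x in Omega & y in set_pow Omega n']
  else [set 1%g].

Definition polynomial_growth (R : realType) : Prop :=
  locally_compact [set: G] /\
  exists (Omega : set G) (mu : {measure set borel -> \bar R}),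
    [/\ compact Omega, symmetric_set Omega, generating Omega, haar_measure mu &
        exists (d : nat) (C : R), 0 < C /\
          forall n : nat, (1 <= n)%N ->
            (mu (set_pow Omega n) <= (C * n%:R ^+ d)%:E)%E].

End growth.

Section actions.
Variables (G : topologicalGroupType) (X : topologicalType).
Variable act : G -> X -> X.

Definition continuous_action : Prop :=
  [/\ forall x, act 1%g x = x,
      forall g h x, act (g * h)%g x = act g (act h x) &
      continuous (fun p : G * X => act p.1 p.2)].

Definition free_action : Prop := forall g x, act g x = x -> g = 1%g.

Definition tube (K : set G) (S : set X) : set X :=
  [set act g x | g in K & x in S].

Definition slice (K : set G) (S : set X) : Prop :=
  compact S /\ set_inj (K `*` S) (fun p : G * X => act p.1 p.2).

Definition tube_interior (K : set G) (S : set X) : set X :=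
  S `&` (tube K S)°.

Definition admits_slices : Prop :=
  forall K : set G, compact K -> nbhs (1%g : G) K ->
  forall x : X, exists2 S : set X, slice K S & tube_interior K S x.

End actions.

(* Main.v *)
(** For [F] defined near [x], continuous and such that each [v |-> F (v y)],
    read in coordinates of [G] near [1], differs from the identity by a map of
    Lipschitz constant 1/2 when [y] is close to [x], the level set of [F]
    through [x] is a slice: the Lipschitz estimate makes [F] injective on short
    pieces of orbits, Banach's fixed point theorem makes these pieces meet the
    level set, and freeness with compactness of [K^-1 K] excludes returns of
    [x] to itself under elements of [K^-1 K] away from [1].
    To obtain [F], extend the coordinates on a piece of the orbit of [x] to a
    continuous [F0 : X -> R^n] (Tietze) and average [h |-> F0 (h^-1 y)] against
    a Lipschitz bump near [1] for the Haar measure. On the orbit of [x] the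
    estimate holds because the product of [G] is C^1 with derivative the sum at
    the identity; for [y] close to [x], left invariance moves the difference
    of the two averages onto the bump, whose Lipschitz constant is multiplied
    by the small quantity [sup |F0 (h^-1 y) - F0 (h^-1 x)|]. *)
From HB Require Import structures.
Require Import Defs.
From mathcomp Require Import all_boot all_order all_algebra.
From mathcomp Require Import all_classical all_reals all_analysis.
From mathcomp Require Import measurable_realfun ring lra.
Import Order.TTheory GRing.Theory Num.Theory.
Import numFieldNormedType.Exports.

Set Implicit Arguments.
Unset Strict Implicit.
Unset Printing Implicit Defensive.

Local Open Scope classical_set_scope.
Local Open Scope ring_scope.

(** * The sup norm on row vectors *)

Lemma coord_le_norm (R : realDomainType) n (x : 'rV[R]_n) i :
  `|x 0 i| <= `|x|.
Proof.
rewrite [leRHS]/Num.norm /= mx_normrE.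
exact: (le_bigmax _ (fun i => `|x i.1 i.2|) (0, i)).
Qed.

Lemma norm_le_coord (R : realDomainType) n (x : 'rV[R]_n) e :
  0 <= e -> (forall i, `|x 0 i| <= e) -> `|x| <= e.
Proof.
move=> e0 xe; rewrite [leLHS]/Num.norm /= mx_normrE; apply: bigmax_le => //.
by move=> [i j] _ /=; rewrite ord1.
Qed.

(** * Strict differentiability of C^1 maps *)

Section strict_differentiability.
Context {R : realType} {m n : nat}.
Implicit Types (f : 'rV[R]_m -> 'rV[R]_n) (w v z : 'rV[R]_m).

Lemma is_derive_along_line f w v (j : 'I_n) (s : R) :
  derivable f (w + s *: v) v ->
  is_derive s 1 (fun t => f (w + t *: v) 0 j) ('D_v f (w + s *: v) 0 j).
Proof.
move=> dfv; have dfj : derivable (fun x => f x 0 j) (w + s *: v) v.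
  exact: (derivable_mxP _ _ _).1.
have E : (fun h : R => h^-1 *: (((fun t => f (w + t *: v) 0 j) \o shift s) (h *: 1)
            - f (w + s *: v) 0 j))
       = (fun h => h^-1 *: (((fun x => f x 0 j) \o shift (w + s *: v)) (h *: v)
            - f (w + s *: v) 0 j)).
  apply/funext => h /=; congr (_ *: (f _ _ _ - _)).
  by rewrite [h *: 1]mulr1 scalerDl addrCA.
split; first by rewrite /derivable E.
by rewrite (derive_mx dfv) !mxE /derive E.
Qed.

(** The scalar mean value theorem, applied to each coordinate of [f] along the segment, which stays
    in the ball by convexity. The intermediate point may vary with the coordinate, which is harmless
    for the sup norm. *)
Lemma line_increment_le f w v z0 (c : 'rV[R]_n) (a d e : R) : 0 <= e -> 0 <= a ->
  `|w - z0| < d -> `|w + a *: v - z0| < d ->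
  (forall z, `|z - z0| < d -> derivable f z v /\ `|'D_v f z - c| <= e) ->
  `|f (w + a *: v) - f w - a *: c| <= e * a.
Proof.
move=> e0 a0 wd wad H.
have segd s : s \in `[0, a] -> `|w + s *: v - z0| < d.
  rewrite in_itv /= => /andP[s0 sa].
  move: s0; rewrite le_eqVlt => /predU1P[<-|s0]; first by rewrite scale0r addr0.
  have a1 : 0 < a := lt_le_trans s0 sa.
  have -> : w + s *: v - z0 =
      (1 - s / a) *: (w - z0) + (s / a) *: (w + a *: v - z0).
    apply/rowP => i; rewrite !mxE; field; lra.
  have sa0 : 0 < s / a by rewrite divr_gt0.
  have sa1 : 0 <= 1 - s / a by rewrite subr_ge0 ler_pdivrMr // mul1r.
  apply: le_lt_trans (ler_normD _ _) _.
  move: (s / a) sa0 sa1 => t t0 t1; rewrite !normrZ (ger0_norm t1) (gtr0_norm t0).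
  nra.
apply: norm_le_coord; first exact: mulr_ge0.
move=> j; rewrite !mxE.
pose g (t : R) := f (w + t *: v) 0 j.
have dg s : s \in `[0, a] -> is_derive s 1 g ('D_v f (w + s *: v) 0 j).
  by move=> /segd /H [? _]; exact: is_derive_along_line.
have dgo s : s \in `]0, a[ -> is_derive s 1 g ('D_v f (w + s *: v) 0 j).
  by move=> sa; apply: dg; apply: subset_itv_oo_cc sa.
have gc : {within `[0, a], continuous g}.
  by apply: derivable_within_continuous => s /dg [].
have [s sa gE] := MVT_segment a0 dgo gc.
move: gE; rewrite /g scale0r addr0 subr0 => ->.
have [_ /(le_trans (coord_le_norm _ j))] := H _ (segd _ sa).
rewrite !mxE [a * _]mulrC -mulrBl normrM (ger0_norm a0) => h.
exact: ler_wpM2r.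
Qed.

(** Going from [z'] to [z] changes one coordinate at a time; each change is controlled by the mean
    value estimate, since the partial derivatives are nearly constant close to [z0]. *)
Lemma class_C1_strict_diff f (U : set 'rV[R]_m) z0 :
  open U -> class_C 1 U f -> U z0 -> forall e, 0 < e ->
  exists2 d, 0 < d & forall z z', `|z - z0| < d -> `|z' - z0| < d ->
    U z /\
    `|f z - f z' - \sum_i (z - z') 0 i *: 'D_(delta_mx 0 i) f z0|
      <= e * `|z - z'|.
Proof.
(* There are [m] coordinate changes, each with error [e']; dividing by [m.+1] also covers
   [m = 0]. *)
move=> oU [_ C1] Uz0 e e0; pose e' := e / m.+1%:R.
have e'0 : 0 < e' by rewrite divr_gt0.
have : \forall z \near z0, U z /\
    forall i : 'I_m, `|'D_(delta_mx 0 i) f z - 'D_(delta_mx 0 i) f z0| <= e'.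
  near=> z; split; first by near: z; exact: open_nbhs_nbhs.
  move=> i; move: i; near: z; apply: filter_forall => i.
  have [_ [+ _]] := C1 i.
  rewrite (continuous_open_subspace _ oU) => /(_ z0 (mem_set Uz0)) /cvgrPdist_le.
  by move=> /(_ _ e'0); apply: filterS => z; rewrite distrC.
case/nbhs_normP => d /= d0 Hd; exists d => // z z' zd z'd.
have Hd' w : `|w - z0| < d -> U w /\ forall i : 'I_m,
    `|'D_(delta_mx 0 i) f w - 'D_(delta_mx 0 i) f z0| <= e'.
  by move=> wd; apply: Hd; rewrite /ball_ /= distrC.
split; first exact: (Hd' z zd).1.
have step w i a : `|w - z0| < d -> `|w + a *: delta_mx 0 i - z0| < d ->
    `|f (w + a *: delta_mx 0 i) - f w - a *: 'D_(delta_mx 0 i) f z0| <= e' * `|a|.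
  have H y : `|y - z0| < d -> derivable f y (delta_mx 0 i) /\
      `|'D_(delta_mx 0 i) f y - 'D_(delta_mx 0 i) f z0| <= e'.
    by move=> /Hd' [Uy Dy]; split => //; apply: (C1 i).1.
  move=> wd wad; have [a0|a0] := leP 0 a.
    by rewrite (ger0_norm a0); apply: line_increment_le H => //; exact: ltW.
  (* For [a < 0], the segment is traversed from its other endpoint, with length [- a]. *)
  have Na0 : 0 <= - a by rewrite oppr_ge0 ltW.
  have := @line_increment_le f (w + a *: delta_mx 0 i) (delta_mx 0 i) z0 _ (- a)
    d e' (ltW e'0) Na0 wad _ H.
  have -> : w + a *: delta_mx 0 i + - a *: delta_mx 0 i = w.
    by rewrite scaleNr addrK.
  move=> /(_ wd).
  rewrite (ltr0_norm a0); apply: le_trans.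
  rewrite -normrN le_eqVlt; apply/orP; left; apply/eqP; congr (`| _ |).
  by apply/rowP => j; rewrite !mxE; ring.
(* The intermediate points: [zk 0] is [z'], [zk m] is [z], and all of them stay in the ball because
   the norm is the sup norm. *)
pose zk k : 'rV[R]_m := \row_i (if (i < k)%N then z 0 i else z' 0 i).
have zkd k : `|zk k - z0| < d.
  apply: (@le_lt_trans _ _ (Num.max `|z - z0| `|z' - z0|)); last first.
    by rewrite gt_max zd z'd.
  apply: norm_le_coord; first by rewrite le_max normr_ge0.
  move=> i; rewrite !mxE le_max; case: ifP => _; apply/orP; [left|right].
    by rewrite (le_trans _ (coord_le_norm _ i)) // !mxE.
  by rewrite (le_trans _ (coord_le_norm _ i)) // !mxE.
have zkS (i : 'I_m) : zk i.+1 = zk i + (z - z') 0 i *: delta_mx 0 i.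
  apply/rowP => j; rewrite !mxE ltnS eqxx /=.
  have [->|ji] := eqVneq j i; first by rewrite leqnn ltnn mulr1 addrC subrK.
  by rewrite mulr0 addr0 leq_eqVlt; move: ji; rewrite -val_eqE => /negPf ->.
have -> : f z - f z' = \sum_(i < m) (f (zk i.+1) - f (zk i)).
  rewrite -(big_mkord xpredT (fun i => f (zk i.+1) - f (zk i))).
  rewrite telescope_sumr //; congr (f _ - f _); apply/rowP => i; rewrite !mxE //.
  by rewrite ltn_ord.
rewrite -sumrB; apply: (le_trans (ler_norm_sum _ _ _)).
apply: (@le_trans _ _ (\sum_(i < m) e' * `|z - z'|)).
  apply: ler_sum => i _; rewrite zkS.
  apply: (@le_trans _ _ (e' * `|(z - z') 0 i|)).
    by apply: step; rewrite -?zkS.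
  by rewrite ler_pM2l // coord_le_norm.
rewrite sumr_const card_ord -mulrnAl ler_wpM2r // -mulr_natl /e' mulrCA.
by apply: ler_piMr; rewrite ?(ltW e0) // ler_pdivrMr // mul1r ler_nat.
Unshelve. all: by end_near. Qed.

End strict_differentiability.

(** * Coordinates of a Lie group near the identity *)

Lemma cvg_mulg (G : topologicalGroupType) T (F : set_system T) {FF : Filter F}
    (f g : T -> G) (a b : G) :
  f @ F --> a -> g @ F --> b -> (f t * g t)%g @[t --> F] --> (a * b)%g.
Proof.
by move=> fa gb; apply: cvg_comp2 fa gb _; exact: (@mulg_continuous G (a, b)).
Qed.

Lemma lsubmx_norm_le (R : realDomainType) n1 n2 (v : 'rV[R]_(n1 + n2)) :
  `|lsubmx v| <= `|v|.
Proof. by apply: norm_le_coord => // i; rewrite mxE coord_le_norm. Qed.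

Lemma rsubmx_norm_le (R : realDomainType) n1 n2 (v : 'rV[R]_(n1 + n2)) :
  `|rsubmx v| <= `|v|.
Proof. by apply: norm_le_coord => // i; rewrite mxE coord_le_norm. Qed.

Lemma row_mx_norm_lt (R : realDomainType) n1 n2 (u : 'rV[R]_n1)
    (v : 'rV[R]_n2) d :
  `|u| < d -> `|v| < d -> `|row_mx u v| < d.
Proof.
move=> ud vd; apply: (@le_lt_trans _ _ (Num.max `|u| `|v|)).
  apply: norm_le_coord => [|i]; first by rewrite le_max normr_ge0.
  by rewrite mxE le_max; case: splitP => j _; rewrite coord_le_norm ?orbT.
by rewrite gt_max ud vd.
Qed.

Lemma lsubmx_continuous (R : realType) n1 n2 :
  continuous (@lsubmx R 1 n1 n2).
Proof.
move=> v; apply/(cvgrPdist_le (FF := nbhs_filter v)) => e e0.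
have : \forall w \near (v : 'rV[R]_(n1 + n2)), `|v - w| <= e.
  by apply/nbhs_normP; exists e => //= w /ltW.
by apply: filterS => w; apply: le_trans; rewrite -raddfB lsubmx_norm_le.
Qed.

Lemma rsubmx_continuous (R : realType) n1 n2 :
  continuous (@rsubmx R 1 n1 n2).
Proof.
move=> v; apply/(cvgrPdist_le (FF := nbhs_filter v)) => e e0.
have : \forall w \near (v : 'rV[R]_(n1 + n2)), `|v - w| <= e.
  by apply/nbhs_normP; exists e => //= w /ltW.
by apply: filterS => w; apply: le_trans; rewrite -raddfB rsubmx_norm_le.
Qed.

(** [theta] parametrizes the neighbourhood [D] of [1] by the closed ball of
    radius [r] around [phi 1], and the difference between the product of [G]
    and vector addition has a small Lipschitz constant there. *)
Record lie_coordinates (R : realType) n (G : topologicalGroupType)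
    (D : set G) (phi : G -> 'rV[R]_n) (theta : 'rV[R]_n -> G) (r : R) : Prop := {
  lc_gt0 : 0 < r ;
  lc_open : open D ;
  lc_1 : D 1%g ;
  lc_continuous : forall g, D g -> {for g, continuous phi} ;
  lc_phiK : forall g, D g -> theta (phi g) = g ;
  lc_dom : forall v, `|v - phi 1%g| <= r -> D (theta v) ;
  lc_thetaK : forall v, `|v - phi 1%g| <= r -> phi (theta v) = v ;
  lc_theta_continuous : forall v, `|v - phi 1%g| <= r ->
    {for v, continuous theta} ;
  lc_mul_dom : forall u v, `|u - phi 1%g| <= r -> `|v - phi 1%g| <= r ->
    D (theta u * theta v)%g ;
  lc_mulr : forall u v v', `|u - phi 1%g| <= r -> `|v - phi 1%g| <= r ->
    `|v' - phi 1%g| <= r ->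
    `|phi (theta u * theta v)%g - phi (theta u * theta v')%g - (v - v')|
      <= 4^-1 * `|v - v'| ;
  lc_mull : forall u u' v, `|u - phi 1%g| <= r -> `|u' - phi 1%g| <= r ->
    `|v - phi 1%g| <= r ->
    `|phi (theta u * theta v)%g - phi (theta u' * theta v)%g|
      <= 2 * `|u - u'| }.

(** The product read in a chart at [1] is C^1 and its derivative at the identity is the sum of the
    two halves, so strict differentiability there yields both Lipschitz estimates. *)
Lemma lie_coordinates_exist (R : realType) n (G : topologicalGroupType)
    (A : set (chart R n G)) : lie_group A ->
  exists D phi theta r, @lie_coordinates R n G D phi theta r.
Proof.
case=> -[hG _ [isA covA _]] [_ /= mulC] _.
have [a Aa a1] := covA 1%g.
have [oD oC phiK' cphi ctheta] := isA a Aa.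
have {mulC} := mulC (prod_chart a a) a (ex_intro2 _ _ a Aa (ex_intro2 _ _ a Aa erefl)) Aa.
move=> /(_ 1%N); rewrite /smooth_in_charts /=.
set D := chart_dom a in a1 oD phiK' cphi *.
set C := chart_cod a in oC ctheta *.
set phi := chart_fun a in phiK' cphi *.
set theta := chart_inv a in phiK' ctheta *.
set U := [set v | _]; set f := (fun v => phi _) => C1.
have CE v : C v -> D (theta v) /\ phi (theta v) = v.
  by case=> g Dg <-; rewrite phiK'.
have CD g : D g -> C (phi g) by move=> Dg; exists g.
(* The codomain of the product chart is an image; splitting it into conditions on the two halves
   makes openness accessible. *)
have UE : U = [set v | (C (lsubmx v) /\ C (rsubmx v)) /\
    D (theta (lsubmx v) * theta (rsubmx v))%g].
  apply/seteqP; split => v /= [].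
    by case=> -[g h] /= [Dg Dh] <-; rewrite row_mxKl row_mxKr => ?; split => //;
      split; exact: CD.
  move=> [Cl Cr] Dv; split => //.
  exists (theta (lsubmx v), theta (rsubmx v)) => /=.
    by split; [case: (CE _ Cl)|case: (CE _ Cr)].
  by rewrite -/phi (CE _ Cl).2 (CE _ Cr).2 hsubmxK.
have thetac v : C v -> {for v, continuous theta}.
  move=> Cv; move: ctheta; rewrite (continuous_open_subspace _ oC).
  by apply; rewrite inE.
have phic g : D g -> {for g, continuous phi}.
  move=> Dg; move: cphi; rewrite (continuous_open_subspace _ oD).
  by apply; rewrite inE.
have oU : open U.
  rewrite UE openE => v /= [[Cl Cr] Dv].
  have H1 : \forall w \near v, C (lsubmx w).
    by apply: lsubmx_continuous; exact: open_nbhs_nbhs.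
  have H2 : \forall w \near v, C (rsubmx w).
    by apply: rsubmx_continuous; exact: open_nbhs_nbhs.
  have H3 : \forall w \near v, D (theta (lsubmx w) * theta (rsubmx w))%g.
    have : (fun w => (theta (lsubmx w) * theta (rsubmx w))%g) @ v -->
        (theta (lsubmx v) * theta (rsubmx v))%g.
      have l := continuous_comp (@lsubmx_continuous _ _ _ v) (thetac _ Cl).
      have r := continuous_comp (@rsubmx_continuous _ _ _ v) (thetac _ Cr).
      exact: (cvg_mulg l r).
    by apply; exact: open_nbhs_nbhs.
  by rewrite /interior; near=> w; split; [split|]; near: w.
pose p := phi 1%g; pose z0 : 'rV[R]_(n + n) := row_mx p p.
have Cp : C p by exact: CD.
have tp : theta p = 1%g by exact: phiK'.
have Uz0 : U z0 by rewrite UE /= row_mxKl row_mxKr tp mul1g.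
have fE u v : f (row_mx u v) = phi (theta u * theta v)%g.
  by rewrite /f row_mxKl row_mxKr.
(* One half of a basis vector vanishes, so one factor of the product is [1] and the difference
   quotient is constant for small nonzero [h]. *)
have Df i : 'D_(delta_mx 0 i) f z0 = lsubmx (delta_mx 0 i) + rsubmx (delta_mx 0 i).
  set e := delta_mx 0 i; apply: cvg_lim => //.
  have nearC (l : 'rV[R]_n) : \forall h \near (0 : R)^', C (h *: l + p).
    apply: nbhs_dnbhs.
    have : (fun h : R => h *: l + p) @ 0 --> 0 *: l + p.
      by apply: cvgD; [apply: cvgZr_tmp; exact: cvg_id|exact: cvg_cst].
    by apply; rewrite scale0r add0r; exact: open_nbhs_nbhs.
  apply: cvg_near_cst.
  have le : (lsubmx e = 0) \/ (rsubmx e = 0).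
    rewrite /e; case: (split_ordP i) => k ->; [right|left]; apply/rowP => j;
      by rewrite !mxE eqxx ?eq_rlshift ?eq_lrshift.
  have z0E : z0 = row_mx p p by [].
  near=> h.
  have h0 : h != 0 by near: h; exact: nbhs_dnbhs_neq.
  have -> : (f \o shift z0) (h *: e) =
      phi (theta (h *: lsubmx e + p) * theta (h *: rsubmx e + p))%g.
    rewrite /= -fE z0E -{1}(hsubmxK e) scale_row_mx add_row_mx //.
  rewrite z0E fE tp mulg1 -/p.
  case: le => ->; rewrite scaler0 !add0r ?addr0 tp ?mulg1 ?mul1g.
    rewrite (CE (h *: rsubmx e + p) _).2 ?addrK ?scalerA ?mulVf ?scale1r //.
    by near: h; exact: nearC.
  rewrite (CE (h *: lsubmx e + p) _).2 ?addrK ?scalerA ?mulVf ?scale1r //.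
  by near: h; exact: nearC.
have [d d0 Hd] := class_C1_strict_diff oU C1 Uz0 (ltac:(by []) : 0 < 4^-1 :> R).
(* Halving [d] turns the open ball of the estimate into a closed one, as the record of coordinates
   asks. *)
have lt_d v : `|v - p| <= d / 2 -> `|v - p| < d.
  by move/le_lt_trans; apply; rewrite ltr_pdivrMr // ltr_pMr // ltr1n.
have diffE (u v u' v' : 'rV[R]_n) :
    row_mx u v - row_mx u' v' = row_mx (u - u') (v - v').
  by rewrite opp_row_mx add_row_mx.
have key u v u' v' : `|u - p| <= d / 2 -> `|v - p| <= d / 2 ->
    `|u' - p| <= d / 2 -> `|v' - p| <= d / 2 ->
    [/\ C u, C v, D (theta u * theta v)%g &
    `|phi (theta u * theta v)%g - phi (theta u' * theta v')%g - (u - u' + (v - v'))|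
      <= 4^-1 * `|row_mx (u - u') (v - v')|].
  move=> ud vd ud' vd'.
  have := Hd (row_mx u v) (row_mx u' v').
  rewrite -[z0]/(row_mx p p) !diffE !row_mx_norm_lt; try exact: lt_d.
  move=> /(_ erefl erefl) [].
  rewrite {1}UE /= row_mxKl row_mxKr => -[[Cu Cv] Duv].
  rewrite !fE; set s := \sum_i _; suff -> : s = u - u' + (v - v') by [].
  rewrite {}/s; under eq_bigr do rewrite Df scalerDr -!linearZ /=.
  by rewrite big_split /= -!raddf_sum -row_sum_delta /= row_mxKl row_mxKr.
have pp : `|p - p| <= d / 2 by rewrite subrr normr0 divr_ge0 // ltW.
exists D, phi, theta, (d / 2); split => //.
- by rewrite divr_gt0.
- by move=> v vd; have [/CE[]] := key v p p p vd pp pp pp.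
- by move=> v vd; have [/CE[]] := key v p p p vd pp pp pp.
- by move=> v vd; apply: thetac; have [] := key v p p p vd pp pp pp.
- by move=> u v ud vd; have [] := key u v p p ud vd pp pp.
- move=> u v v' ud vd vd'; have [_ _ _] := key u v u v' ud vd ud vd'.
  rewrite subrr add0r => /le_trans; apply; rewrite ler_wpM2l //.
  apply: norm_le_coord => // i; rewrite mxE; case: splitP => j _.
    by rewrite mxE normr0.
  exact: coord_le_norm.
- move=> u u' v ud ud' vd; have [_ _ _] := key u v u' v ud vd ud' vd.
  rewrite subrr addr0 => H.
  have {}H : `|phi (theta u * theta v)%g - phi (theta u' * theta v)%g - (u - u')|
      <= 4^-1 * `|u - u'|.
    apply: (le_trans H); rewrite ler_wpM2l //.
    apply: norm_le_coord => // i; rewrite mxE; case: splitP => j _.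
      exact: coord_le_norm.
    by rewrite mxE normr0.
  rewrite -[X in `|X|](subrK (u - u')); apply: (le_trans (ler_normD _ _)).
  by have := normr_ge0 (u - u'); lra.
Unshelve. all: by end_near. Qed.

(** * Integration of compactly supported functions against a Haar measure *)

Section haar_integral.
Context {R : realType} {G : topologicalGroupType}.
Local Notation borel := (g_sigma_algebraType (@open G)).

Definition compactly_supported (f : G -> R) :=
  continuous f /\ exists2 K, compact K & forall g, ~ K g -> f g = 0.

Lemma mulg_continuousl (g : G) : continuous (fun h : G => (g * h)%g).
Proof. by move=> h; apply: cvg_mulg; [exact: cvg_cst|exact: cvg_id]. Qed.

Lemma compactly_supported_translate (f : G -> R) (g : G) :
  compactly_supported f -> compactly_supported (fun h => f (g * h)%g).
Proof.
move=> [cf [K cK f0]]; split.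
  by move=> h; exact: (continuous_comp (mulg_continuousl (x := h)) (cf _)).
exists ((fun h => g^-1 * h)%g @` K).
  apply: continuous_compact cK; apply: continuous_subspaceT.
  exact: mulg_continuousl.
move=> h Kh; apply: f0 => Kgh; apply: Kh; exists (g * h)%g => //.
by rewrite monoid.mulgA monoid.mulVg monoid.mul1g.
Qed.

Lemma open_borel (U : set G) : open U -> measurable (U : set borel).
Proof. exact: sub_sigma_algebra. Qed.

Lemma continuous_borel (f : G -> R) :
  continuous f -> measurable_fun setT (f : borel -> R).
Proof.
move=> /continuousP cf; apply: (measurability _ (RGenOpens.measurableE R)).
move=> _ [_ [a [b ->] <-]]; rewrite setTI; apply: open_borel.
exact/cf/interval_open.
Qed.

Lemma mulgl_borel (g : G) :
  measurable_fun setT ((fun h => g * h)%g : borel -> borel).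
Proof.
apply: (@measurability _ _ borel borel _ _ (@open G)) => //.
move=> _ [U oU <-]; rewrite setTI; apply: open_borel.
by move: U oU; apply/continuousP; exact: mulg_continuousl.
Qed.

Variable mu : {measure set borel -> \bar R}.
Hypotheses (hG : hausdorff_space G) (hmu : haar_measure mu).

Lemma compact_borel (K : set G) : compact K -> measurable (K : set borel).
Proof.
move=> /(compact_closed hG) cK; rewrite -[K]setCK; apply: measurableC.
by apply: open_borel; exact: closed_openC.
Qed.

Lemma haar_compact_lty (K : set G) : compact K -> (mu K < +oo)%E.
Proof. by case: hmu => _ _ h _ _; exact: h. Qed.

Lemma haar_integrable (f : G -> R) : compactly_supported f ->
  mu.-integrable setT (EFin \o f).
Proof.
move=> [cf [K cK f0]]; have mK := compact_borel cK.
have -> : EFin \o f = (EFin \o f) \_ (K : set borel).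
  apply/funext => g; rewrite patchE; case: ifPn => // /negP gK.
  by rewrite /= f0 // => Kg; apply: gK; rewrite inE.
apply/(integrable_mkcond _ mK).
apply: (@measurable_bounded_integrable _ borel R mu (f : borel -> R)) => //.
- exact: haar_compact_lty.
- by apply: measurable_funTS; exact: continuous_borel.
- have : compact (f @` K).
    by apply: continuous_compact cK; exact: continuous_subspaceT.
  move=> /compact_bounded [M [Mr HM]]; exists M; split => // x Mx g Kg.
  by apply: (HM _ Mx); exists g.
Qed.

(** The image of [mu] under left translation is [mu] itself; the change of variables formula then
    applies. *)
Lemma haar_integral_translate (f : G -> R) (g : G) : compactly_supported f ->
  \int[mu]_h f (g * h)%g = \int[mu]_h f h.
Proof.
move=> csf; rewrite /Rintegral; congr fine.
have [cf _] := csf.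
have mf := (@measurable_EFinP _ borel R setT f).2 (continuous_borel cf).
rewrite -(@integral_pushforward _ _ borel borel R _ (mulgl_borel g) mu setT
  (EFin \o f) mf _ measurableT); last first.
  rewrite preimage_setT.
  exact: (haar_integrable (compactly_supported_translate g csf)).
apply: eq_measure_integral => [|mg B mB _]; first exact: mulgl_borel.
rewrite /pushforward; case: hmu => _ inv _ _ _.
rewrite -(inv g^-1%g B mB); congr (mu _); apply/seteqP; split => h /=.
  move=> Bgh; exists (g * h)%g => //.
  by rewrite monoid.mulgA monoid.mulVg monoid.mul1g.
move=> [k Bk <-].
by rewrite monoid.mulgA monoid.mulgV monoid.mul1g.
Qed.

Lemma haar_integral_bound (f : G -> R) (K : set G) (M : R) :
  continuous f -> compact K -> (forall g, ~ K g -> f g = 0) ->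
  (forall g, K g -> `|f g| <= M) ->
  `|\int[mu]_g f g| <= M * fine (mu K).
Proof.
move=> cf cK f0 fM; have mK := compact_borel cK.
have csf : compactly_supported f by split => //; exists K.
have intf := haar_integrable csf.
have fE : f = f \_ K.
  apply/funext => g; rewrite patchE; case: ifPn => // /negP gK.
  by rewrite f0 // => Kg; apply: gK; rewrite inE.
have intK : mu.-integrable (K : set borel) (EFin \o f).
  exact: integrableS intf.
have -> : \int[mu]_g f g = \int[mu]_(g in K) f g.
  by rewrite [RHS]Rintegral_mkcond -fE.
apply: le_trans (le_normr_Rintegral mK intK) _.
have muK := haar_compact_lty cK.
rewrite -(Rintegral_cst mu mK M); apply: le_Rintegral => //.
- exact: integrable_norm.
- apply: (@measurable_bounded_integrable _ borel R mu (cst M)) => //.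
  exists `|M|; split; first exact: num_real.
  by move=> x Mx g _ /=; exact: ltW.
Qed.

(** If [V] were null, so would be every compact set, being covered by finitely many translates of
    [V]; inner regularity would then make the whole group null. *)
Lemma haar_open_gt0 (V : set G) : open V -> V 1%g -> (0 < mu V)%E.
Proof.
move=> oV V1; rewrite lt0e measure_ge0 andbT; apply/eqP => V0.
case: hmu => mu0 inv _ _ inner.
move/eqP: mu0; apply; rewrite (inner setT openT).
suff -> : [set mu K | K in [set K : set G | compact K /\ K `<=` setT]] = [set 0%E].
  by rewrite ereal_sup1.
apply/seteqP; split => [_ [K [cK _] <-]|_ ->]; last first.
  by exists set0; [split => //; exact: compact0|rewrite measure0].
have oT g : open [set (g * x)%g | x in V].
  have -> : [set (g * x)%g | x in V] = (fun h => g^-1 * h)%g @^-1` V.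
    apply/seteqP; split => h /=.
      by move=> [k Vk <-]; rewrite monoid.mulgA monoid.mulVg monoid.mul1g.
    move=> Vh; exists (g^-1 * h)%g => //.
    by rewrite monoid.mulgA monoid.mulgV monoid.mul1g.
  by move: V oV {V1 V0}; apply/continuousP; exact: mulg_continuousl.
have T0 g : mu [set (g * x)%g | x in V] = 0%E.
  by rewrite inv //; exact: open_borel.
move: (cK); rewrite compact_cover.
move=> /(_ G setT (fun g => [set (g * x)%g | x in V])) [] //.
  by move=> g _; exists g => //; exists 1%g; rewrite ?monoid.mulg1.
move=> D _; rewrite /cover bigcup_fset => sub.
set U := \big[_/_]_(i <- _) _ in sub.
have [mU U0] : measurable (U : set borel) /\ mu U = 0%E.
  rewrite /U; elim: (finmap.enum_fset D) => [|g s [ms s0]].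
    by rewrite big_nil; split => //; exact: measure0.
  rewrite big_cons; split; first by apply: measurableU => //; exact: open_borel.
  by rewrite measureU0 //; exact: open_borel.
apply: (@subset_measure0 _ borel R mu K U) => //; exact: compact_borel.
Qed.

(** The function exceeds half its value at [1] on an open neighbourhood of [1], which has positive
    measure. *)
Lemma haar_integral_gt0 (f : G -> R) : compactly_supported f ->
  (forall g, 0 <= f g) -> 0 < f 1%g -> 0 < \int[mu]_g f g.
Proof.
move=> csf f0 f1; have [cf [K cK fK]] := csf.
pose V : set G := f @^-1` `]f 1%g / 2, +oo[.
have oV : open V by move/continuousP: cf; apply; exact: interval_open.
have V1 : V 1%g by rewrite /V /= in_itv /= andbT ltr_pdivrMr // ltr_pMr // ltr1n.
have VK : V `<=` K.
  move=> g /=; rewrite /V /= in_itv /= andbT => fg; apply: contrapT => /fK fg0.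
  by move: fg; rewrite fg0 ltNge divr_ge0 // ltW.
have muV : (mu V < +oo)%E.
  case: hmu => _ _ /(_ _ cK) muK _ _; apply: le_lt_trans muK.
  by apply: le_measure => //; rewrite inE; [exact: open_borel|exact: compact_borel].
have intf := haar_integrable csf.
have mV : measurable (V : set borel) by exact: open_borel.
have : f 1%g / 2 * fine (mu V) <= \int[mu]_g f g.
  rewrite -(Rintegral_cst mu mV (f 1%g / 2)) Rintegral_mkcond.
  apply: le_Rintegral => //.
  - rewrite -restrict_EFin; apply/(integrable_mkcond _ mV).
    apply: (@measurable_bounded_integrable _ borel R mu (cst (f 1%g / 2))) => //.
    exists `|f 1%g / 2|; split; first exact: num_real.
    by move=> x Mx g _ /=; exact: ltW.
  - move=> g _; rewrite patchE; case: ifPn => // /set_mem.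
    by rewrite /V /= in_itv /= andbT => /ltW.
apply: lt_le_trans; rewrite mulr_gt0 ?divr_gt0 // fine_gt0 // muV andbT.
exact: haar_open_gt0.
Qed.

End haar_integral.

(** * Extension of continuous maps from compact sets *)

Section compact_extension.
Context {R : realType} {X : topologicalType}.
Hypotheses (hXlc : locally_compact [set: X]) (hXh : hausdorff_space X).

(* A locally compact Hausdorff space need not be normal, but its one-point
   compactification is, and Tietze's theorem applies there. *)
Lemma compact_tietze (K : set X) (f : X -> R) :
  compact K -> {within K, continuous f} ->
  exists2 g : X -> R, continuous g & forall x, K x -> g x = f x.
Proof.
move=> cK cf; pose Y := one_point_compactification X.
have hY : hausdorff_space Y by exact: one_point_compactification_hausdorff.
have nY : normal_space Y.
  exact: compact_normal hY one_point_compactification_compact.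
pose fY (y : Y) : R := if y is Some x then f x else 0.
have clA : closed (Some @` K : set Y).
  apply: (compact_closed hY); apply: continuous_compact cK.
  by apply: continuous_subspaceT; exact: one_point_compactification_some_continuous.
have cfY : {within (Some @` K : set Y), continuous fY}.
  apply/subspace_continuousP => _ [x Kx <-] W /= Wfx.
  move/subspace_continuousP: cf => /(_ x Kx W Wfx) /= H.
  rewrite /nbhs /= /within /= in H *.
  by move: H; apply: filterS => z /= H [z' Kz' [zz']]; apply: H; rewrite -zz'.
have [M [_ HM]] : bounded_set (f @` K).
  by apply: compact_bounded; exact: continuous_compact cK.
(* The bound has to be positive, and [bounded_set] only gives bounds strictly above [M]; [|M| + 1]
   meets both demands. *)
have [||g [gf cg _]] := @continuous_bounded_extension Y R nY _ clA fY (`|M| + 1) _ cfY.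
- by rewrite ltr_wpDl.
- move=> _ [x Kx <-] /=; apply: (HM (`|M| + 1)); last by exists x.
  by rewrite (le_lt_trans (ler_norm M)) // ltrDl.
exists (g \o Some).
  move=> x; apply: continuous_comp; last exact: cg.
  exact: one_point_compactification_some_continuous.
by move=> x Kx; rewrite /= -gf // inE; exists x.
Qed.

Lemma compact_tietze_rV n (K : set X) (f : X -> 'rV[R]_n) :
  compact K -> {within K, continuous f} ->
  exists2 g : X -> 'rV[R]_n, continuous g & forall x, K x -> g x = f x.
Proof.
move=> cK cf.
have H (i : 'I_n) : {g : X -> R | continuous g /\ forall x, K x -> g x = f x 0 i}.
  apply: cid; have [|g cg gf] := @compact_tietze K (fun x => f x 0 i) cK.
    move=> x; apply: (@continuous_comp (subspace K) _ _ f (fun v => v 0 i) x).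
      exact: cf.
    exact: coord_continuous.
  by exists g.
exists (fun x => \row_i sval (H i) x).
  move=> x; apply/(cvgrPdist_le (FF := nbhs_filter x)) => e e0.
  have : \forall y \near x, forall i, `|sval (H i) x - sval (H i) y| <= e.
    apply: filter_forall => i; case: (svalP (H i)) => /(_ x) + _.
    by move/cvgrPdist_le => /(_ _ e0).
  apply: filterS => y Hy; apply: norm_le_coord; first exact: ltW.
  by move=> i; rewrite !mxE.
by move=> x Kx; apply/rowP => i; rewrite mxE; case: (svalP (H i)) => _ ->.
Qed.

Lemma extension_along_injection n (T : ptopologicalType) (h : T -> X)
    (K : set T) (f : T -> 'rV[R]_n) :
  compact K -> continuous h -> set_inj K h -> {within K, continuous f} ->
  exists2 g : X -> 'rV[R]_n, continuous g & forall t, K t -> g (h t) = f t.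
Proof.
move=> cK ch hinj cf.
pose k (x : X) : T := get [set t | K t /\ h t = x].
have kP t : K t -> k (h t) = t.
  move=> Kt; have [Kk hk] := @getPex _ [set t' | K t' /\ h t' = h t]
    (ex_intro _ t (conj Kt erefl)).
  by apply: hinj => //; rewrite inE.
have cfk : {within h @` K, continuous (f \o k)}.
  apply/subspace_continuousP => _ [t Kt <-] W Wfk.
  have Wft : nbhs (f t) W.
    exact: (eq_ind _ (fun t' => nbhs (f t') W) Wfk _ (kP t Kt)).
  (* Compactness of [K] lets this be checked near each [t']: by continuity of [f] if [t' = t], and
     vacuously otherwise, since [h t'] and [h t] have disjoint neighbourhoods. *)
  suff : \forall x \near h t, K `<=` (fun t' => h t' = x -> W (f t')).
    rewrite /nbhs /= /within /=; apply: filterS => x H [t' Kt' xE].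
    by have := H t' Kt' xE; rewrite -{1}(kP t' Kt') xE.
  move: cK => /compact_near_coveringP/near_covering_withinP; apply => t' Kt'.
  have [->|tt'] := eqVneq t' t.
    move/subspace_continuousP: cf => /(_ t Kt W Wft) H.
    exists ([set s | K s -> W (f s)], setT); first by split => //; exact: filterT.
    by move=> [s x] /= [+ _] Ks; move=> /(_ Ks).
  have htt' : h t' != h t.
    by apply: contra_neq tt' => /hinj; apply; rewrite inE.
  move: hXh; rewrite open_hausdorff => /(_ _ _ htt') [[A B]] /= [].
  rewrite !inE => At' Bt [oA oB AB0].
  exists (h @^-1` A, B).
    split; last exact: open_nbhs_nbhs.
    by apply: ch; exact: open_nbhs_nbhs.
  move=> [s x] /= [As Bx] _ sx; exfalso.
  have : (A `&` B) x by split => //; rewrite -sx.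
  by rewrite AB0.
have [g cg gE] := compact_tietze_rV (continuous_compact (continuous_subspaceT ch) cK) cfk.
exists g => // t Kt; rewrite gE /= ?kP //; by exists t.
Qed.

End compact_extension.

(** * Coordinate balls and Lipschitz bumps around the identity *)

Section coordinate_balls.
Context {R : realType} {n : nat} {G : topologicalGroupType}.
Context {D : set G} {phi : G -> 'rV[R]_n} {theta : 'rV[R]_n -> G} {r : R}.
Hypotheses (hG : hausdorff_space G) (lc : lie_coordinates D phi theta r).

Definition coord_ball s : set G := [set theta v | v in [set v | `|v - phi 1%g| <= s]].

Lemma theta_phi1 : theta (phi 1%g) = 1%g.
Proof. exact: (lc_phiK lc (lc_1 lc)). Qed.

Lemma center_le s : 0 <= s -> `|phi 1%g - phi 1%g| <= s.
Proof. by rewrite subrr normr0. Qed.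

Lemma coord_ball_dom s g : s <= r -> coord_ball s g -> D g.
Proof. by move=> sr [v vs <-]; apply: (lc_dom lc); exact: le_trans sr. Qed.

Lemma coord_ball_compact s : s <= r -> compact (coord_ball s).
Proof.
move=> sr; apply: continuous_compact.
  apply/subspace_continuousP => v vs; apply: cvg_within_filter.
  by apply: (lc_theta_continuous lc); exact: le_trans sr.
apply: bounded_closed_compact.
  exists (`|phi 1%g| + s); split; first exact: num_real.
  move=> M sM v /= vs; rewrite ltW //; apply: le_lt_trans sM.
  by rewrite -[v](subrK (phi 1%g)) addrC (le_trans (ler_normD _ _)) // lerD2l.
have -> : [set v | `|v - phi 1%g| <= s] = closed_ball_ Num.norm (phi 1%g) s.
  by apply/seteqP; split => v; rewrite /closed_ball_ /= distrC.
exact: closed_closed_ball_.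
Qed.

Lemma coord_open_ball_nbhs s : 0 < s ->
  nbhs 1%g [set theta v | v in [set v | `|v - phi 1%g| < s]].
Proof.
move=> s0; have H1 : \forall g \near (1%g : G), D g.
  by apply: open_nbhs_nbhs; split; [exact: (lc_open lc)|exact: (lc_1 lc)].
have H2 : \forall g \near (1%g : G), `|phi 1%g - phi g| < s.
  have /cvgrPdist_lt := lc_continuous lc (lc_1 lc).
  exact.
apply: filterS2 H1 H2 => g Dg gs; exists (phi g); first by rewrite /= distrC.
exact: (lc_phiK lc).
Qed.

Lemma coord_ball_nbhs s : 0 < s -> nbhs 1%g (coord_ball s).
Proof.
by move=> /coord_open_ball_nbhs; apply: filterS => g [v /ltW vs <-]; exists v.
Qed.

Lemma coord_ball_sub (W : set G) b : nbhs 1%g W -> 0 < b ->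
  exists s, [/\ 0 < s, s <= b & coord_ball s `<=` W].
Proof.
move=> W1 b0; have : \forall v \near phi 1%g, W (theta v).
  apply: (lc_theta_continuous lc (center_le (ltW (lc_gt0 lc)))).
  by rewrite theta_phi1.
case/nbhs_normP => e /= e0 He.
exists (Num.min b (e / 2)); rewrite lt_min b0 divr_gt0 //; split => //.
  by rewrite ge_min lexx.
move=> _ [v vs <-]; apply: He; rewrite /ball_ /= distrC.
move: vs; rewrite /= le_min => /andP[_ /le_lt_trans]; apply.
by rewrite ltr_pdivrMr // ltr_pMr // ltr1n.
Qed.

(** The test on [D] is needed because [phi] has arbitrary values outside [D]. *)
Definition bump s (g : G) : R :=
  if pselect (D g) then Num.max 0 (s - `|phi g - phi 1%g|) else 0.

Lemma bump_ge0 s g : 0 <= bump s g.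
Proof. by rewrite /bump; case: pselect => //= _; rewrite le_max lexx. Qed.

Lemma bump1_gt0 s : 0 < s -> 0 < bump s 1%g.
Proof.
rewrite /bump; case: pselect => [?|] /=; last by have := lc_1 lc.
by rewrite subrr normr0 subr0 lt_max orbC => ->.
Qed.

Lemma bump_eq0 s g : ~ coord_ball s g -> bump s g = 0.
Proof.
rewrite /bump; case: pselect => //= Dg gs; apply/max_idPl.
rewrite subr_le0 leNgt; apply/negP => /ltW gs'; apply: gs.
by exists (phi g) => //; exact: (lc_phiK lc).
Qed.

Lemma bump_lipschitz s g g' : D g -> D g' ->
  `|bump s g - bump s g'| <= `|phi g - phi g'|.
Proof.
move=> Dg Dg'; rewrite /bump; do 2 case: pselect => //= _.
have H : `|(`|phi g - phi 1%g| - `|phi g' - phi 1%g|)| <= `|phi g - phi g'|.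
  by apply: le_trans (ler_dist_dist _ _) _; rewrite opprB addrA subrK.
apply: le_trans H; move: `|phi g - _| `|phi g' - _| => a b.
have m1 := ler_norm (a - b); have := ler_norm (b - a); rewrite distrC => m2.
rewrite ler_norml /Num.max.
by do 2 case: ltP => ?; apply/andP; split; lra.
Qed.

(** Inside [D] this is the Lipschitz bound. A point outside [D] lies in the complement of the
    compact, hence closed, coordinate ball, an open set on which the bump vanishes. *)
Lemma bump_continuous s : s <= r -> continuous (bump s).
Proof.
move=> sr g; have [Dg|Dg] := pselect (D g).
  apply/cvgrPdist_le => e e0.
  have H1 : \forall h \near g, D h.
    by apply: open_nbhs_nbhs; split => //; exact: (lc_open lc).
  have H2 : \forall h \near g, `|phi g - phi h| <= e.
    by have /cvgrPdist_le := lc_continuous lc Dg; exact.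
  apply: filterS2 H1 H2 => h Dh; apply: le_trans.
  exact: bump_lipschitz.
have oC : open (~` coord_ball s).
  by apply: closed_openC; apply: (compact_closed hG); exact: coord_ball_compact.
have nC : (~` coord_ball s) g by move=> /(coord_ball_dom sr).
apply: cvg_near_cst; rewrite (bump_eq0 nC).
have : \forall h \near g, (~` coord_ball s) h by apply: open_nbhs_nbhs.
by apply: filterS => h; exact: bump_eq0.
Qed.

Lemma bump_compactly_supported s : s <= r -> compactly_supported (bump s).
Proof.
move=> sr; split; first exact: bump_continuous.
by exists (coord_ball s); [exact: coord_ball_compact|exact: bump_eq0].
Qed.

End coordinate_balls.

Arguments coord_ball {R n G} phi theta s.
Arguments bump {R n G} D phi s.
Arguments bump_ge0 {R n G} D phi s.
Arguments center_le {R n G} phi {s}.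

(** * Weighted averages of vector-valued functions on the group *)

Lemma compactly_supportedM (R : realType) (G : topologicalGroupType)
    (f w : G -> R) : compactly_supported f -> continuous w ->
  compactly_supported (fun g => f g * w g).
Proof.
move=> [cf [K cK f0]] cw; split.
  by move=> g; apply: cvgM; [exact: cf|exact: cw].
by exists K => // g /f0 ->; rewrite mul0r.
Qed.

Section averaging.
Context {R : realType} {n : nat} {G : topologicalGroupType}.
Local Notation borel := (g_sigma_algebraType (@open G)).
Variables (mu : {measure set borel -> \bar R}) (rho : G -> R) (K : set G).
Hypotheses (hG : hausdorff_space G) (hmu : haar_measure mu).
Hypotheses (crho : continuous rho) (cK : compact K)
  (rhoK : forall g, ~ K g -> rho g = 0) (rho0 : forall g, 0 <= rho g)
  (rho1 : 0 < rho 1%g).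
Implicit Types w : G -> 'rV[R]_n.

Let csrho : compactly_supported rho.
Proof. by split => //; exists K. Qed.

(** The division by the mass of [rho] makes the average fix constants. *)
Definition average w : 'rV[R]_n :=
  \row_i ((\int[mu]_h rho h)^-1 * \int[mu]_h (rho h * w h 0 i)).

Lemma continuous_coord w i : continuous w -> continuous (fun h => w h 0 i).
Proof.
move=> cw h; apply: (@continuous_comp _ _ _ w (fun v => v 0 i) h) (cw h) _.
exact: coord_continuous.
Qed.

Let integrable_rhoM (u : G -> R) : continuous u ->
  mu.-integrable setT (EFin \o (fun h => rho h * u h)).
Proof.
by move=> cu; apply: haar_integrable => //; exact: compactly_supportedM.
Qed.

Let integrable_rho_coord w i : continuous w ->
  mu.-integrable setT (EFin \o (fun h => rho h * w h 0 i)).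
Proof. by move=> cw; apply: integrable_rhoM; exact: continuous_coord. Qed.

Let int_rho_gt0 : 0 < \int[mu]_h rho h.
Proof. exact: haar_integral_gt0. Qed.

Let inv_int_rho_ge0 : 0 <= (\int[mu]_h rho h)^-1.
Proof. by rewrite invr_ge0 ltW. Qed.

Lemma averageB w w' : continuous w -> continuous w' ->
  average w - average w' = average (fun h => w h - w' h).
Proof.
move=> cw cw'; apply/rowP => i; rewrite !mxE -mulrBr; congr (_ * _).
rewrite -RintegralB //; try exact: integrable_rho_coord.
by apply: eq_Rintegral => h _; rewrite !mxE mulrBr.
Qed.

Lemma average_cst v : average (fun=> v) = v.
Proof.
apply/rowP => i; rewrite mxE RintegralZr //; last exact: haar_integrable.
by rewrite mulrA mulVf ?mul1r // gt_eqF.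
Qed.

Lemma norm_average_le w M : continuous w -> 0 <= M ->
  (forall h, K h -> `|w h| <= M) -> `|average w| <= M.
Proof.
move=> cw M0 wM; apply: norm_le_coord => // i; rewrite mxE normrM.
rewrite (ger0_norm inv_int_rho_ge0) ler_pdivrMl //.
apply: (le_trans (le_normr_Rintegral _ _)) => //.
  exact: integrable_rho_coord.
rewrite -RintegralZr //; last exact: haar_integrable.
apply: le_Rintegral => //.
- by apply: integrable_norm; exact: integrable_rho_coord.
- by apply: integrable_rhoM => ?; exact: cvg_cst.
move=> h _; have [Kh|/rhoK ->] := pselect (K h); last by rewrite !mul0r normr0.
by rewrite normrM ger0_norm // ler_wpM2l // (le_trans (coord_le_norm _ i)) // wM.
Qed.

(* Averages of [w] and of a left translate of [w] are compared by moving the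
   translation to the weight [rho]. *)
Lemma norm_average_translate_le w (g g' : G) (Q : set G) (L M : R) :
  continuous w -> compact Q -> 0 <= L -> 0 <= M ->
  (forall h, ~ Q h -> rho (g * h)%g = 0 /\ rho (g' * h)%g = 0) ->
  (forall h, Q h -> `|rho (g * h)%g - rho (g' * h)%g| <= L) ->
  (forall h, Q h -> `|w h| <= M) ->
  `|average (fun h => w (g^-1 * h)%g) - average (fun h => w (g'^-1 * h)%g)|
    <= (\int[mu]_h rho h)^-1 * (L * M * fine (mu Q)).
Proof.
move=> cw cQ L0 M0 Q0 QL QM; apply: norm_le_coord => [|i].
  by rewrite mulr_ge0 // mulr_ge0 ?mulr_ge0 // fine_ge0.
have cwi := continuous_coord (i := i) cw.
(* Substituting [k * h] for [h] leaves the Haar integral unchanged. *)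
have tr k : \int[mu]_h (rho h * w (k^-1 * h)%g 0 i) =
    \int[mu]_h (rho (k * h)%g * w h 0 i).
  rewrite -(@haar_integral_translate _ _ _ hG hmu
    (fun h => rho h * w (k^-1 * h)%g 0 i) k).
    apply: eq_Rintegral => h _.
    by rewrite monoid.mulgA monoid.mulVg monoid.mul1g.
  apply: compactly_supportedM => // h.
  exact: (continuous_comp (mulg_continuousl (x := h)) (cwi _)).
have csk k : compactly_supported (fun h => rho (k * h)%g * w h 0 i).
  by apply: compactly_supportedM => //; exact: compactly_supported_translate.
rewrite !mxE !tr -mulrBr normrM (ger0_norm inv_int_rho_ge0) ler_wpM2l //.
rewrite -RintegralB //; try exact: haar_integrable.
apply: haar_integral_bound => //.
- by move=> h; apply: cvgB; [exact: (csk g).1|exact: (csk g').1].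
- by move=> h /Q0[-> ->]; rewrite !mul0r subrr.
move=> h Qh; rewrite -mulrBl normrM ler_pM //; first exact: QL.
by rewrite (le_trans (coord_le_norm _ i)) // QM.
Qed.

End averaging.

(** * Solving equations for Lipschitz perturbations of the identity *)

HB.instance Definition _ (R : realType) m n := Complete.on 'M[R]_(m, n).

(** The solutions of [Psi v = q] are the fixed points of [T], a contraction of ratio 1/2 of the
    closed ball of radius [t]. *)
Lemma near_inverse_surjective (R : realType) n (Psi : 'rV[R]_n -> 'rV[R]_n)
    (p q : 'rV[R]_n) (t : R) : 0 < t ->
  (forall v v', `|v - p| <= t -> `|v' - p| <= t ->
    `|Psi v - Psi v' - (v - v')| <= 2^-1 * `|v - v'|) ->
  `|q - Psi p| <= t / 2 -> exists2 v, `|v - p| <= t & Psi v = q.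
Proof.
move=> t0 Psi_id qp; pose T v := v - Psi v + q.
pose U : set 'rV[R]_n := closed_ball_ Num.norm p t.
have UE v : U v -> `|v - p| <= t by rewrite /U /closed_ball_ /= distrC.
have Up : U p by rewrite /U /closed_ball_ /= subrr normr0 ltW.
have TT v v' : U v -> U v' -> `|T v - T v'| <= 2^-1 * `|v - v'|.
  move=> /UE vt /UE vt'; rewrite (le_trans _ (Psi_id _ _ vt vt')) // -normrN.
  rewrite le_eqVlt; apply/orP; left; apply/eqP; congr (`| _ |).
  by rewrite /T; apply/rowP => i; rewrite !mxE; ring.
have TU : set_fun U U T.
  move=> v Uv; rewrite /U /closed_ball_ /=.
  (* Each of the two terms contributes at most [t / 2]. *)
  have -> : p - T v = (T p - T v) - (q - Psi p).
    by rewrite /T; apply/rowP => i; rewrite !mxE; ring.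
  apply: (le_trans (ler_normB _ _)).
  have := TT _ _ Up Uv; have : `|p - v| <= t by [].
  lra.
pose f : {fun U >-> U} := HB.pack T (isFun.Build _ _ U U T TU).
have cf : is_contraction f.
  exists (2^-1)%:nng; split => /=; first by rewrite invf_lt1 // ltr1n.
  by move=> [v v'] [/= Uv Uv']; exact: TT.
have [v Uv vE] := banach_fixed_point cf (closed_closed_ball_ (x := p) (e := t))
  (ex_intro _ p Up).
exists v; first exact: UE.
have {}vE : v = v - Psi v + q by [].
apply/rowP => i; have := congr1 (fun z : 'rV[R]_n => z 0 i) vE.
by rewrite !mxE; lra.
Qed.

(** * Orbit maps of a free continuous action *)

Section local_sections.
Context {R : realType} {n : nat} {G : topologicalGroupType} {X : topologicalType}.
Context {act : G -> X -> X}.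
Hypotheses (hG : hausdorff_space G) (hXlc : locally_compact [set: X])
  (hXh : hausdorff_space X) (hact : continuous_action act)
  (hfree : free_action act).

Lemma cvg_act T (F : set_system T) {FF : Filter F} (f : T -> G) (u : T -> X) g x :
  f @ F --> g -> u @ F --> x -> act (f t) (u t) @[t --> F] --> act g x.
Proof.
move=> fg ux; apply: cvg_comp2 fg ux _.
by case: hact => _ _ /(_ (g, x)).
Qed.

Lemma orbit_continuous x : continuous (act^~ x).
Proof. by move=> g; apply: cvg_act; [exact: cvg_id|exact: cvg_cst]. Qed.

Lemma actVK g x : act g^-1%g (act g x) = x.
Proof.
by case: hact => a1 aM _; rewrite -aM monoid.mulVg a1.
Qed.

Lemma orbit_inj x g h : act g x = act h x -> g = h.
Proof.
move=> gh; have : act (h^-1 * g)%g x = x.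
  by case: hact => _ aM _; rewrite aM gh actVK.
move=> /hfree /(congr1 (fun k => h * k)%g).
by rewrite monoid.mulgA monoid.mulgV monoid.mul1g monoid.mulg1.
Qed.

Lemma translates_equicontinuous (F0 : X -> 'rV[R]_n) (Q : set G) y e :
  continuous F0 -> compact Q -> 0 < e ->
  \forall y' \near y, Q `<=`
    (fun h => `|F0 (act h^-1%g y') - F0 (act h^-1%g y)| <= e).
Proof.
move=> cF /compact_near_coveringP cQ e0; apply: cQ => h _.
have c : (fun z : G * X => F0 (act z.1^-1%g z.2)) @ (h, y) --> F0 (act h^-1%g y).
  apply: (@cvg_comp _ _ _ (fun z : G * X => act z.1^-1%g z.2) F0); last exact: cF.
  apply: cvg_act; last exact: cvg_snd.
  by apply: (@cvg_comp _ _ _ fst (fun g : G => g^-1%g));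
    [exact: cvg_fst|exact: invg_continuous].
(* Both [(h', y')] and [(h', y)] are compared with [(h, y)], each at cost [e / 2]. *)
have e2 : 0 < e / 2 by rewrite divr_gt0.
have /cvgrPdist_le /(_ _ e2) [[A B] /= [nA nB] AB] := c.
exists (A, B) => //= -[h' y'] /= [Ah' By'].
have H1 := AB (h', y') (conj Ah' By').
have H2 := AB (h', y) (conj Ah' (nbhs_singleton nB)).
rewrite (splitr e); apply: le_trans (lerD H1 H2) => /=.
rewrite -[X in _ <= X + _]normrN -[X in X <= _](normrN) -[X in `|X|]opprK.
rewrite opprK (le_trans _ (ler_normD _ _)) //.
rewrite le_eqVlt; apply/orP; left; apply/eqP; rewrite -normrN; congr (`| _ |).
by apply/rowP => i; rewrite !mxE; ring.
Qed.

End local_sections.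

(** * Construction of the local coordinate map and of the slices *)

Section slices.
Context {R : realType} {n : nat} {G : topologicalGroupType} {X : topologicalType}.
Context {act : G -> X -> X}.
Context {D : set G} {phi : G -> 'rV[R]_n} {theta : 'rV[R]_n -> G} {r : R}.
Local Notation borel := (g_sigma_algebraType (@open G)).
Variable mu : {measure set borel -> \bar R}.
Hypotheses (hG : hausdorff_space G) (hXlc : locally_compact [set: X])
  (hXh : hausdorff_space X) (hact : continuous_action act)
  (hfree : free_action act) (lc : lie_coordinates D phi theta r)
  (hmu : haar_measure mu).

(* [F] is the average over a small bump around [1] of a continuous function
   [F0] that reads the coordinates [phi] on the orbit of [x]. *)
Lemma local_coordinate_map (x : X) :
  exists (F : X -> 'rV[R]_n) (t : R), [/\ continuous F, 0 < t, t <= r &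
    \forall y \near x, forall v v', `|v - phi 1%g| <= t -> `|v' - phi 1%g| <= t ->
      `|F (act (theta v) y) - F (act (theta v') y) - (v - v')|
        <= 2^-1 * `|v - v'|].
Proof.
have r0 := lc_gt0 lc.
have cr := coord_ball_compact lc (lexx r).
have inj : set_inj (coord_ball phi theta r) (act^~ x).
  by move=> g h _ _; exact: (orbit_inj hact hfree).
have cphi : {within coord_ball phi theta r, continuous phi}.
  apply/subspace_continuousP => g gr; apply: cvg_within_filter.
  by apply: (lc_continuous lc); exact: (coord_ball_dom lc (lexx r)).
have [F0 cF0 F0E] :=
  extension_along_injection hXlc hXh cr (orbit_continuous hact (x := x)) inj cphi.
have r4 : 0 < r / 4 by rewrite divr_gt0.
(* The radius [r / 4] leaves room for the product of [h^-1] with another element of that ball to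
   stay where [F0] reads [phi]. *)
have W1 : \forall h \near (1%g : G), coord_ball phi theta (r / 4) h^-1%g.
  have : (fun h : G => h^-1%g) @ (1%g : G) --> (1%g : G).
    by rewrite -[X in _ --> X]monoid.invg1; exact: invg_continuous.
  by apply; exact: (coord_ball_nbhs lc).
(* This will confine the supports of the translated bumps to the ball of radius [r]. *)
have W2 : \forall h \near (1%g : G) & k \near (1%g : G),
    coord_ball phi theta r (h^-1 * k)%g.
  have : (fun z : G * G => (z.1^-1 * z.2)%g) @ (1%g, 1%g) --> (1%g : G).
    have e : (1%g : G) = (1^-1 * 1)%g by rewrite monoid.mulVg.
    rewrite [X in _ --> X]e; apply: cvg_mulg; last exact: cvg_snd.
    by apply: (@cvg_comp _ _ _ fst (fun g : G => g^-1%g));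
      [exact: cvg_fst|exact: invg_continuous].
  by apply; exact: (coord_ball_nbhs lc).
have [[A B] /= [nA nB] AB] := W2.
have [s [s0 sr sW]] := coord_ball_sub lc (filterI W1 (filterI nA nB)) r4.
have rr : r / 4 <= r by lra.
have sr' : s <= r := le_trans sr rr.
pose rho := bump D phi s.
have crho : continuous rho := bump_continuous hG lc sr'.
have cK := coord_ball_compact lc sr'.
have rhoK : forall g, ~ coord_ball phi theta s g -> rho g = 0 := bump_eq0 lc (s := s).
have rho0 : forall g, 0 <= rho g := bump_ge0 D phi s.
have rho1 : 0 < rho 1%g := bump1_gt0 lc s0.
have c0 : 0 < \int[mu]_h rho h.
  by apply: haar_integral_gt0 => //; exact: (bump_compactly_supported hG lc sr').
pose w y h := F0 (act h^-1%g y).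
have cw y : continuous (w y).
  move=> h; apply: (@cvg_comp _ _ _ (fun g : G => act g^-1%g y) F0); last exact: cF0.
  by apply: (cvg_act hact); [exact: invg_continuous|exact: cvg_cst].
pose F y := average mu rho (w y).
have wE g y : w (act g y) = fun h => w y (g^-1 * h)%g.
  apply/funext => h; rewrite /w monoid.invgM monoid.invgK.
  by case: hact => _ -> _.
exists F, s; split => //.
  move=> y; apply/(cvgrPdist_le (FF := nbhs_filter y)) => e e0.
  apply: filterS (translates_equicontinuous hact y cF0 cK e0) => y' He.
  rewrite distrC /F (averageB hG hmu crho cK rhoK) //.
  apply: (norm_average_le hG hmu crho cK rhoK rho0 rho1) => //; last exact: ltW.
  by move=> h; apply: cvgB; exact: cw.
pose m := fine (mu (coord_ball phi theta r)).
have m0 : 0 <= m by exact: fine_ge0.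
pose c := \int[mu]_h rho h.
(* Chosen so that the factor [2 * m / c] of the translation estimate turns it into at most 1/4;
   [m + 1] is positive as soon as [0 <= m]. *)
have eta0 : 0 < c / (8 * (m + 1)) by rewrite divr_gt0 // mulr_gt0 // ltr_wpDl.
apply: filterS (translates_equicontinuous hact x cF0 cr eta0) => y Hy v v' vs vs'.
have vr4 := le_trans vs sr; have vr4' := le_trans vs' sr.
have vr := le_trans vr4 rr; have vr' := le_trans vr4' rr.
(* On the orbit of [x] the estimate holds under the integral, where [F0] is [phi] and the difference
   is that of two products in coordinates. *)
have E1 : `|F (act (theta v) x) - F (act (theta v') x) - (v - v')|
    <= 4^-1 * `|v - v'|.
  have cwx z : continuous (w (act z x)) by exact: cw.
  rewrite -{1}[v - v'](average_cst hG hmu crho cK rhoK rho0 rho1).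
  rewrite /F (averageB hG hmu crho cK rhoK) //.
  rewrite (averageB hG hmu crho cK rhoK); last 2 first.
  - by move=> h; apply: cvgB; exact: cwx.
  - by move=> h; exact: cvg_cst.
  apply: (norm_average_le hG hmu crho cK rhoK rho0 rho1).
  - move=> h; apply: cvgB; last exact: cvg_cst.
    by apply: cvgB; exact: cwx.
  - by rewrite mulr_ge0.
  move=> h /sW [/= [u us uE] _].
  have ur : `|u - phi 1%g| <= r := le_trans us rr.
  have F0uE z : `|z - phi 1%g| <= r / 4 -> `|z - phi 1%g| <= r ->
      w (act (theta z) x) h = phi (theta u * theta z)%g.
    move=> zr4 zr; rewrite /w -uE; case: (hact) => _ <- _; apply: F0E.
    exists (phi (theta u * theta z)%g); last first.
      by apply: (lc_phiK lc); exact: (lc_mul_dom lc).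
    have := lc_mulr lc ur zr (center_le phi (ltW r0)).
    rewrite (theta_phi1 lc) monoid.mulg1 (lc_thetaK lc ur) => H.
    (* The three terms are at most [r / 16], [r / 4] and [r / 4]. *)
    rewrite /=; have -> : phi (theta u * theta z)%g - phi 1%g =
      (phi (theta u * theta z)%g - u - (z - phi 1%g)) + (u - phi 1%g) + (z - phi 1%g).
      by apply/rowP => i; rewrite !mxE; ring.
    apply: (le_trans (ler_normD _ _)).
    have := ler_normD (phi (theta u * theta z)%g - u - (z - phi 1%g)) (u - phi 1%g).
    have us' : `|u - phi 1%g| <= r / 4 := us.
    lra.
  by rewrite !F0uE //; exact: (lc_mulr lc).
(* Passing from [x] to [y] costs another 1/4: the difference of the two functions is small on the
   ball of radius [r], and the translation falls on the Lipschitz bump. *)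
have E2 : `|F (act (theta v) y) - F (act (theta v') y)
    - (F (act (theta v) x) - F (act (theta v') x))| <= 4^-1 * `|v - v'|.
  pose u h := w y h - w x h.
  have cu : continuous u by move=> h; apply: cvgB; exact: cw.
  have FE g : F (act g y) - F (act g x) = average mu rho (fun h => u (g^-1 * h)%g).
    by rewrite /F (averageB hG hmu crho cK rhoK) // !wE.
  have -> : F (act (theta v) y) - F (act (theta v') y)
      - (F (act (theta v) x) - F (act (theta v') x)) =
      (F (act (theta v) y) - F (act (theta v) x))
      - (F (act (theta v') y) - F (act (theta v') x)).
    by apply/rowP => i; rewrite !mxE; ring.
  have out z h : `|z - phi 1%g| <= s -> ~ coord_ball phi theta r h ->
      rho (theta z * h)%g = 0.
    move=> zs hr; apply: rhoK => /sW [_ [_ Bzh]]; apply: hr.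
    have [_ [Az _]] : coord_ball phi theta (r / 4) (theta z)^-1%g /\
        (A (theta z) /\ B (theta z)) by apply: sW; exists z.
    have := AB (theta z, (theta z * h)%g) (conj Az Bzh) => /=.
    by rewrite monoid.mulgA monoid.mulVg monoid.mul1g.
  rewrite !FE; apply: le_trans (norm_average_translate_le hG hmu crho cK rhoK rho0 rho1
    (L := 2 * `|v - v'|) (M := c / (8 * (m + 1))) cu cr _ (ltW eta0) _ _ _) _.
  - by rewrite mulr_ge0.
  - by move=> h hr; split; exact: out.
  - move=> h [z zr <-]; apply: le_trans (lc_mull lc vr vr' zr).
    by apply: bump_lipschitz; exact: (lc_mul_dom lc).
  - by move=> h hr; exact: Hy.
  rewrite -/m -/c.
  have m1 : m + 1 != 0 by rewrite gt_eqF // ltr_wpDl.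
  have c1 : c != 0 by rewrite gt_eqF.
  have -> : c^-1 * (2 * `|v - v'| * (c / (8 * (m + 1))) * m) =
      4^-1 * `|v - v'| * (m / (m + 1)).
    by field; rewrite m1 c1.
  rewrite ler_piMr // ?mulr_ge0 // ler_pdivrMr ?mul1r ?lerDl //.
  by rewrite ltr_wpDl.
have -> : F (act (theta v) y) - F (act (theta v') y) - (v - v') =
   (F (act (theta v) y) - F (act (theta v') y)
    - (F (act (theta v) x) - F (act (theta v') x))) +
   (F (act (theta v) x) - F (act (theta v') x) - (v - v')).
  by apply/rowP => i; rewrite !mxE; ring.
apply: (le_trans (ler_normD _ _)); lra.
Qed.

(** Regularity at [x] gives a neighbourhood with closure inside [M]; intersecting this closure with
    a compact neighbourhood makes it compact. *)
Lemma compact_nbhs_sub (x : X) (M : set X) : nbhs x M ->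
  exists N, [/\ compact N, nbhs x N & N `<=` M].
Proof.
move=> xM; have [U] := hXlc (x := x) I; rewrite withinET => xU [cU _].
have [C xC CM] := compact_regular hXh cU xU xM.
exists (U `&` closure C); split.
- by apply: compact_closedI => //; exact: closed_closure.
- by apply: filterI xU _; apply: filterS xC; exact: subset_closure.
- by move=> y [_ /CM].
Qed.

(* By freeness, an element of the compact set [K^-1 K] that moves a point close
   to [x] to another point close to [x] is itself close to [1]. *)
Lemma near_stabilizer (x : X) (K : set G) (W : set G) : compact K ->
  nbhs 1%g W -> \forall y \near x & z \near x,
    forall g h, K g -> K h -> act g y = act h z -> W (h^-1 * g)%g.
Proof.
move=> cK W1.
have KK : compact [set (z.2^-1 * z.1)%g | z in K `*` K].
  apply: continuous_compact; last exact: (compact_setX cK cK).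
  apply: continuous_subspaceT => z; apply: cvg_mulg; last exact: cvg_fst.
  by apply: (@cvg_comp _ _ _ snd (fun g : G => g^-1%g));
    [exact: cvg_snd|exact: invg_continuous].
have : \forall yz \near (x, x), [set (z.2^-1 * z.1)%g | z in K `*` K] `<=`
    (fun g => act g yz.1 = yz.2 -> W g).
  move/compact_near_coveringP: KK => KK.
  apply: (KK _ (nbhs (x, x)) (fun yz g => act g yz.1 = yz.2 -> W g)) => g _.
  have [g1|g1] := eqVneq g 1%g.
    rewrite g1; exists (W, setT); first by split => //; exact: filterT.
    by move=> [h yz] /= [].
  (* Disjoint neighbourhoods of [act g x] and [x] rule out [act h y = z] for [h] near [g] and [y],
     [z] near [x]. *)
  have : act g x != x by apply: contra_neq g1; exact: hfree.
  move: hXh; rewrite open_hausdorff => /[apply] -[[A B]] /= [].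
  rewrite !inE => Agx Bx [oA oB AB0].
  have nA : nbhs (act g x) A by exact: open_nbhs_nbhs.
  have [_ _ /(_ (g, x) A nA) [[P Q] /= [nP nQ] PQ]] := hact.
  exists (P, Q `*` B).
    split => //=; exists (Q, B) => //; split => //; exact: open_nbhs_nbhs.
  move=> [h [y z]] /= [Ph [Qy Bz]] hyz; exfalso.
  have : (A `&` B) z by split => //; rewrite -hyz; exact: (PQ (h, y)).
  by rewrite AB0.
apply: filterS => -[y z] /= H g h Kg Kh gh.
apply: (H (h^-1 * g)%g); first by exists (g, h).
by case: (hact) => _ aM _; rewrite aM gh (actVK hact).
Qed.

(** The slice is cut out of the level set of [F] through [x] by a compact neighbourhood of [x] on
    which both [near_stabilizer] and the Lipschitz estimate are available. *)
Lemma slice_exists (K : set G) (x : X) : compact K -> nbhs (1%g : G) K ->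
  exists2 S : set X, slice act K S & tube_interior act K S x.
Proof.
move=> cK K1; have [F [t [cF t0 tr HF]]] := local_coordinate_map x.
have a1 y : act 1%g y = y by case: hact.
have [[M1 M2] /= [nM1 nM2] HM] :=
  near_stabilizer x cK (coord_ball_nbhs lc t0).
have [N [cN nN NM]] := compact_nbhs_sub (filterI (filterI nM1 nM2) HF).
pose S := N `&` F @^-1` [set F x].
have xS : S x by split => //; exact: nbhs_singleton nN.
exists S; last split=> //.
  split.
    apply: compact_closedI cN _; apply: preimage_closed; first by move=> y _; exact: cF.
    by apply: accessible_closed_set1; apply: hausdorff_accessible; exact: norm_hausdorff.
  move=> [g y] [h z]; rewrite !inE /= => -[Kg [Ny Fy]] [Kh [Nz Fz]] /= gh.
  have [[M1y M2y] Hy] := NM _ Ny; have [[M1z M2z] _] := NM _ Nz.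
  have [v vt vE] := HM (y, z) (conj M1y M2z) g h Kg Kh gh.
  have yz : act (h^-1 * g)%g y = z.
    by case: (hact) => _ aM _; rewrite aM gh (actVK hact).
  (* As [F] agrees at [y] and [z], the estimate bounds [|v - phi 1|] by half of itself, so [theta v]
     is [1]. *)
  have := Hy v (phi 1%g) vt (center_le phi (ltW t0)).
  rewrite (theta_phi1 lc) a1 vE yz Fy Fz subrr sub0r normrN => H.
  have {H} : `|v - phi 1%g| <= 0.
    have H' : `|v - phi 1%g| <= 2^-1 * `|v - phi 1%g| := H.
    lra.
  rewrite normr_le0 subr_eq0 => /eqP vp.
  move: vE; rewrite vp (theta_phi1 lc) => hg1.
  move: yz; rewrite -hg1 a1 => ->; congr (_, _).
  have := congr1 (fun k => h * k)%g hg1.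
  by rewrite monoid.mulg1 monoid.mulgA monoid.mulgV monoid.mul1g.
have nN1 : nbhs (act 1%g x) N by rewrite a1.
have [_ _ /(_ (1%g, x) N nN1) [[P Q] /= [nP nQ] PQ]] := hact.
have KV : \forall g \near (1%g : G), K g^-1%g.
  have : (fun h : G => h^-1%g) @ (1%g : G) --> (1%g : G).
    by rewrite -[X in _ --> X]monoid.invg1; exact: invg_continuous.
  exact.
(* For [v] within [s] of [phi 1], the inverse of [theta v] is in [K] and [theta v] keeps points of
   [Q] inside [N]. *)
have [s [s0 st sW]] := coord_ball_sub lc (filterI KV nP) t0.
have s2 : 0 < s / 2 by rewrite divr_gt0.
have Fnear : \forall y \near x, `|F x - F y| <= s / 2.
  by have /cvgrPdist_le := cF x; exact.
apply: filterS (filterI (filterI nQ HF) Fnear) => y [[Qy Hy] Fxy].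
(* The short piece of the orbit of [y] meets the level set at [act (theta v) y], and [(theta v)^-1]
   brings this point back to [y]. *)
have [||v vs Fv] := @near_inverse_surjective R n (fun v => F (act (theta v) y))
  (phi 1%g) (F x) s s0.
- by move=> v v' vs vs'; apply: Hy; exact: le_trans st.
- by rewrite (theta_phi1 lc) a1.
have [Kv Pv] : K (theta v)^-1%g /\ P (theta v) by apply: sW; exists v.
exists (theta v)^-1%g => //; exists (act (theta v) y); last exact: (actVK hact).
by split => //; exact: (PQ (theta v, y)).
Qed.

End slices.

Theorem corollary3p15 (R : realType) (n : nat) (G : topologicalGroupType)
    (A : set (chart R n G)) (hA : lie_group A) (hconn : connected [set: G])
    (hgrowth : polynomial_growth G R)
    (X : topologicalType) (hX2 : @second_countable X)
    (hXlc : locally_compact [set: X]) (hXh : hausdorff_space X)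
    (act : G -> X -> X) (hact : continuous_action act)
    (hfree : free_action act) :
  admits_slices act.
Proof.
move=> K cK K1 x; have [[hG _ _] _ _] := hA.
have [_ [_ [mu [_ _ _ hmu _]]]] := hgrowth.
have [D [phi [theta [r lc]]]] := lie_coordinates_exist hA.
exact: (slice_exists hG hXlc hXh hact hfree lc hmu x cK K1).
Qed.
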